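(* Let $p$ be a prime, $H>0$, and let $\{X_n\}_{n\in\mathbb{N}_0}$ be a dt-ss-si process of type II with scaling function $b(n)=(|n|_p)^H$. Then: (1) $X_0=0$ almost surely. (2) $\{X_n\}_{n\in\mathbb{N}_0}$ is recurrent, in the sense that each $X_n$ is a limit point of the sequence $\{X_n\}_{n\in\mathbb{N}_0}$ almost surely. (3) $X_1\overset{d}{=}-X_1$. Consequently, $\mathbb{E}(|X_1|)<\infty$ implies $\mathbb{E}(X_n)=0$ for all $n\in\mathbb{N}_0$. (4) For $m,n\in\mathbb{N}_0$ with $m\neq n$, $\mathbb{P}(X_m=X_n)=\mathbb{P}(X_m=X_n=0)=\mathbb{P}(X_i=0\text{ for all } i\in\mathbb{N}_0)$. (5) $X_1$ has no atom except possibly at zero. (6) Let $a=\sup\{x\geq 0:\mathbb{P}(|X_1|<x)=0\}$ and $\beta=\inf\{x>0:\mathbb{P}(|X_1|>x)=0\}$. Then $\beta\geq(1+2p^{-H})a$. (7) If $\mathbb{E}(X_1^2)<\infty$, then for any $m,n\in\mathbb{N}_0$, $$\mathrm{Cov}(X_n,X_m)=\frac12\left((|n|_p)^{2H}+(|m|_p)^{2H}-(|n-m|_p)^{2H}\right)\mathrm{Var}(X_1).$$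
   Context: $\mathbb{N}=\{1,2,\dots\}$, $\mathbb{N}_0=\{0,1,2,\dots\}$; $\overset{d}{=}$ denotes equality in distribution. $|n|_p=p^{-v_p(n)}$ is the $p$-adic norm of an integer $n\neq0$, and $|0|_p=0$. $\inf\emptyset=+\infty$. A limit point of a sequence is the limit of some subsequence of it. A real-valued process $\{X_m\}_{m\in\mathbb{N}_0}$ is dt-ss-si with scaling function $b:\mathbb N\to(0,\infty)$ if $\{X_{nm}\}_{m\in\mathbb{N}_0}\overset{d}{=}\{b(n)X_m\}_{m\in\mathbb{N}_0}$ for every $n\in\mathbb{N}$, and $\{X_{m+1}-X_m\}_{m\in\mathbb{N}_0}\overset{d}{=}\{X_{m+k+1}-X_{m+k}\}_{m\in\mathbb{N}_0}$ for every $k\in\mathbb{N}$. It is of type II if $b(n)=(|n|_p)^H$, $n\in\mathbb N$, for some prime $p$ and some $H>0$. *)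

(* Defs.v *)
From HB Require Import structures.
From mathcomp Require Import all_boot all_order all_algebra.
From mathcomp Require Import all_classical all_reals all_analysis.
Import Order.TTheory GRing.Theory Num.Theory.
Import numFieldNormedType.Exports.

Set Implicit Arguments.
Unset Strict Implicit.
Unset Printing Implicit Defensive.

Local Open Scope classical_set_scope.
Local Open Scope ring_scope.

Definition padic_norm (R : realType) (p : nat) (n : int) : R :=
  if n == 0 then 0 else p%:R ^- logn p `|n|%N.

Definition eq_distr d (T : measurableType d) (R : realType)
    (P : probability T R) d' (U : measurableType d') (Y Z : T -> U) : Prop :=
  forall A : set U, measurable A -> P (Y @^-1` A) = P (Z @^-1` A).

(* The product sigma-algebra on R^nat is the one generated by these sets. *)
Definition coordinate_cylinders (R : realType) : set (set (nat -> R)) :=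
  [set C | exists i : nat, exists2 B : set R,
    measurable B & C = [set u | B (u i)]].

Definition path_space (R : realType) :=
  g_sigma_algebraType (@coordinate_cylinders R).

Definition sample_path d (T : measurableType d) (R : realType)
  (Y : nat -> T -> R) (w : T) : path_space R := fun m => Y m w.

Definition eq_distr_process d (T : measurableType d) (R : realType)
    (P : probability T R) (Y Z : nat -> T -> R) : Prop :=
  eq_distr P (sample_path Y) (sample_path Z).

(* A scaling function is defined on positive integers only: the value [b 0] is
   irrelevant. *)
Definition dt_ss_si d (T : measurableType d) (R : realType)
    (P : probability T R) (X : nat -> {RV P >-> R}) (b : nat -> R) : Prop :=
  [/\ forall n, (0 < n)%N -> 0 < b n,
      forall n, (0 < n)%N ->
        eq_distr_process P (fun m w => X (n * m)%N w) (fun m w => b n * X m w) &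
      forall k, (0 < k)%N ->
        eq_distr_process P (fun m w => X m.+1 w - X m w)
          (fun m w => X (m + k).+1 w - X (m + k)%N w)].

Definition seq_limit_point (R : realType) (u : nat -> R) (x : R) : Prop :=
  exists2 f : nat -> nat, increasing_seq f & u \o f @ \oo --> x.

(* Main.v *)
Require Import Defs.
From HB Require Import structures.
From mathcomp Require Import all_boot all_order all_algebra.
From mathcomp Require Import all_classical all_reals all_analysis.
From mathcomp Require Import measurable_realfun.
From mathcomp Require Import ring lra.
Import Order.TTheory GRing.Theory Num.Theory.
Import numFieldNormedType.Exports.

Local Open Scope classical_set_scope.
Local Open Scope ring_scope.

Set Implicit Arguments.
Unset Strict Implicit.
Unset Printing Implicit Defensive.

(** Scaling by [p ^ k] multiplies the process by [padic_ratio ^+ k], which tends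
    to [0], and scaling by a number prime to [p] preserves its law. The first
    fact gives [X 0 = 0], and with stationary increments it makes
    [X (n + p ^ k) - X n] small in probability: the paths are [p]-adically
    continuous in probability, hence recurrent. The symmetry of [X 1] comes from
    [X (p ^ k) = X (p ^ k - 1) + (X (p ^ k) - X (p ^ k - 1))], a small sum of two
    variables that are distributed as [X 1].

    The substance is the statement on coincidences. Any two distinct times
    coincide with the same probability [q = P (X 1 = 0)], and it must be shown
    that [X n = 0] forces [X m = 0]. If the process is indexed by the [p]-adic
    integers, then the mean sum of the squared densities of the level sets of a
    path is [q] in balls of every radius; so the martingales formed by these
    densities along shrinking balls are constant, and a level set has measure
    [0] or [1]. The finite form used here replaces the martingales by
    positivity. The kernel [(s, t) |-> P (E /\ X s = X t)] is positive
    semidefinite for every event [E] ([coincidence_gram_ge0]), and on the whole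
    space it is constant off the diagonal. Therefore the uniform masses on two
    large finite sets of times are nearly the same vector for the full kernel,
    hence also for its smaller part on [E], and the events [X t = 0] have nearly
    the same average probability on [E] along both sets
    ([coincidence_sum_le]). Choose for [E] the event that [X m] is away from
    [0], and for the sets of times the multiples of [m] and of [n] by many units
    close to [1]. Near [m] the path is away from [0] on [E] by continuity, so on
    [E] it is rarely zero at the multiples of [n] either; invariance under units
    brings this back to [n] itself ([pr_zero_gt]).

    Absence of atoms follows: distinct times coincide only on zero paths, so the
    events [X t = x], [x <> 0], for different times [t] prime to [p] are almost
    surely disjoint, and they have the same probability. The ratio of the edges
    of the support of [`|X 1|] comes from the position of the four values [X 0],
    [X 1], [X p] and [X (p + 1)] when [`|X 1|] is close to its lower edge
    ([four_point_gap]). The covariances follow by polarization. *)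

(** * Quadratic forms *)

(** Grouping the indices by the value that [z] takes on them turns the form into
    a sum of squares, one for each value. *)
Lemma gram_indicator_ge0 (R : realDomainType) (I V : eqType) (s : seq I)
    (c : I -> R) (z : I -> V) :
  0 <= \sum_(i <- s) \sum_(j <- s) c i * c j * (z i == z j)%:R.
Proof.
pose vs := undup (map z s).
suff -> : \sum_(i <- s) \sum_(j <- s) c i * c j * (z i == z j)%:R =
    \sum_(v <- vs) (\sum_(i <- s) c i * (z i == v)%:R) ^+ 2.
  by apply: sumr_ge0 => v _; exact: sqr_ge0.
under [RHS]eq_bigr do rewrite expr2 big_distrlr/=.
rewrite [RHS]exchange_big/= big_seq [RHS]big_seq; apply: eq_bigr => i si.
rewrite [RHS]exchange_big/=; apply: eq_bigr => j _.
rewrite (bigD1_seq (z i)) ?undup_uniq//=; last by rewrite mem_undup map_f.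
rewrite eqxx mulr1 big1 ?addr0 => [|v]; first by rewrite (eq_sym (z j)) mulrA.
by rewrite eq_sym => /negbTE->; rewrite mulr0 mul0r.
Qed.

(** The quadratic form of a kernel [K] on the signed measure that puts the mass
    [c] at [0], a unit mass at each [a i] and a mass [-1] at each [b i]. *)
Lemma gram_three_blocks (R : comRingType) (K : nat -> nat -> R) (c : R)
    (a b : nat -> nat) (N : nat) :
  let s := (c, 0%N) :: [seq (1, a i) | i <- iota 0 N] ++
                      [seq (-1, b i) | i <- iota 0 N] in
  \sum_(x <- s) \sum_(y <- s) x.1 * y.1 * K x.2 y.2 =
  c ^+ 2 * K 0%N 0%N
  + c * (\sum_(i < N) K 0%N (a i) - \sum_(i < N) K 0%N (b i))
  + c * (\sum_(i < N) K (a i) 0%N - \sum_(i < N) K (b i) 0%N)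
  + \sum_(i < N) \sum_(j < N)
      (K (a i) (a j) + K (b i) (b j) - K (a i) (b j) - K (b i) (a j)).
Proof.
move=> s.
have mapE (f : R * nat -> R) t (g : nat -> nat) :
    \sum_(x <- [seq (t, g i) | i <- iota 0 N]) f x = \sum_(i < N) f (t, g i).
  by rewrite big_map -(big_mkord xpredT (fun i => f (t, g i))) /index_iota subn0.
have inner t v : \sum_(y <- s) t * y.1 * K v y.2 =
    t * (c * K v 0%N + \sum_(i < N) K v (a i) - \sum_(i < N) K v (b i)).
  rewrite /s big_cons big_cat !mapE/= !mulrBr !mulrDr !mulr_sumr -sumrN.
  rewrite addrA mulrA.
  by congr (_ + _ + _); apply: eq_bigr => i _; ring.
under eq_bigr do rewrite inner.
rewrite /s big_cons big_cat !mapE/=.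
under [X in _ + (X + _)]eq_bigr do rewrite mul1r.
under [X in _ + (_ + X)]eq_bigr do rewrite mulN1r.
rewrite sumrN !sumrB !big_split/= -!mulr_sumr.
under [X in _ = _ + X]eq_bigr do rewrite !sumrB big_split/=.
by rewrite !sumrB !big_split/=; ring.
Qed.

(** * Four points on a line *)

(** Think of [0] and [xp] as one class of points, and of [x1] and [xq] as another
    one: points of different classes are at a distance in [[x, y]], points of the
    same class at a distance in [[c x, c y]]. When the gap between [0] and [x1]
    is nearly minimal, neither of the other two points fits between them. If
    [xp] and [xq] lie on different sides of the gap, or on the same side and the
    farther one belongs to the class of the nearer end of the gap, then some
    distance between the classes is at least [x + 2 c x]. Otherwise the farther
    one and the farther end of the gap are points of one class at a distance of
    at least [2 x + c x], so that [y] is at least [(2 x + c x) / c], which is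
    larger still. *)
Lemma four_point_gap (R : realFieldType) (c x y x1 xp xq : R) :
  0 < c -> c < 1 -> 0 < x ->
  x <= `|x1| <= y -> c * x <= `|xp| <= c * y -> x <= `|xq| <= y ->
  x <= `|xp - x1| <= y -> c * x <= `|xq - x1| <= c * y ->
  x <= `|xq - xp| <= y -> `|x1| < x * (1 + c) -> (1 + 2 * c) * x <= y.
Proof.
move=> c0 c1 x0; wlog x1_ge0 : x1 xp xq / 0 <= x1.
  move=> th; have [|/ltW] := lerP 0 x1; first exact: th.
  by rewrite -oppr_ge0 => /(th _ (- xp) (- xq)); rewrite -!opprD !normrN; exact.
rewrite (ger0_norm x1_ge0) => /andP[a1 _] /andP[a2 b2] /andP[a3 b3]
  /andP[a4 b4] /andP[a5 b5] /andP[a6 b6] x1c.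
rewrite leNgt; apply/negP => yx.
have a0 : 0 < c * x by rewrite mulr_gt0.
have ax : c * x < x by rewrite gtr_pMl.
have cy : c * y < 3 * (c * x).
  rewrite [ltRHS]mulrCA ltr_pM2l//; apply: lt_le_trans yx _.
  by rewrite ler_pM2r//; lra.
(* The signs of all the distances from [x1] are settled by those of [xp] and
   [xq]; what is left is linear in [x], [c * x] and [c * y]. *)
move: a2 b2 a4 b4; have [xp0|xp0] := ger0P xp => a2 b2;
  have [xpx|xpx] := ger0P (xp - x1) => a4 b4; try lra;
  move: a3 b3 a5 b5; have [xq0|xq0] := ger0P xq => a3 b3;
  have [xqx|xqx] := ger0P (xq - x1) => a5 b5; try lra;
  move: a6 b6; have [xqp|xqp] := ger0P (xq - xp) => a6 b6; lra.
Qed.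

(** * Probabilities as real numbers *)

Section Probability.
Context {d : measure_display} {T : measurableType d} {R : realType}.
Variable P : probability T R.
Implicit Types (A B C : set T) (Y Z : T -> R).

Local Notation pr A := (fine (P A)).

Lemma prK A : measurable A -> P A = (pr A)%:E.
Proof. by move=> mA; rewrite fineK// fin_num_measure. Qed.

Lemma pr_ge0 A : 0 <= pr A.
Proof. exact: fine_ge0. Qed.

Lemma le_pr A B : measurable A -> measurable B -> A `<=` B -> pr A <= pr B.
Proof.
move=> mA mB AB; rewrite fine_le ?fin_num_measure//.
by rewrite le_measure// inE.
Qed.

Lemma le_pr_setU A B C : measurable A -> measurable B -> measurable C ->
  A `<=` B `|` C -> pr A <= pr B + pr C.
Proof.
move=> mA mB mC ABC; have mBC := measurableU _ _ mB mC.
rewrite -lee_fin EFinD -!prK//.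
apply: le_trans (measureU2 _ mB mC).
by rewrite le_measure// inE.
Qed.

Lemma pr_splitI A B : measurable A -> measurable B ->
  pr B = pr (A `&` B) + pr (~` A `&` B).
Proof.
move=> mA mB; have mAB := measurableI _ _ mA mB.
have mACB := measurableI _ _ (measurableC mA) mB.
apply: EFin_inj; rewrite EFinD -!prK// -measureU//.
- by rewrite -setIUl setUv setTI.
- by rewrite setIACA setICr set0I.
Qed.

Lemma measurable_eqs Y Z : measurable_fun setT Y -> measurable_fun setT Z ->
  measurable [set w | Y w = Z w].
Proof.
move=> mY mZ; have /(_ measurableT [set true]) := measurable_fun_eqr mY mZ.
rewrite setTI (_ : _ @^-1` _ = [set w | Y w = Z w]); first exact.
by apply/seteqP; split => w /= /eqP.
Qed.

Lemma measurable_lts Y Z : measurable_fun setT Y -> measurable_fun setT Z ->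
  measurable [set w | Y w < Z w].
Proof.
move=> mY mZ; have /(_ measurableT [set true]) := measurable_fun_ltr mY mZ.
rewrite setTI; exact.
Qed.

Lemma measurable_gts_norm Y (e : R) : measurable_fun setT Y ->
  measurable [set w | e < `|Y w|].
Proof.
by move=> mY; apply: measurable_lts => //; exact: measurableT_comp.
Qed.

Lemma sum_pr_ge0 (I : Type) (s : seq I) (c : I -> R) (A : I -> set T) :
  (forall i, measurable (A i)) ->
  (forall w, 0 <= \sum_(i <- s) c i * \1_(A i) w) ->
  0 <= \sum_(i <- s) c i * pr (A i).
Proof.
move=> mA c0.
have intA i : P.-integrable setT (fun w => (c i * \1_(A i) w)%:E).
  have := @integrableZl _ _ _ P setT measurableT (c i) (EFin \o \1_(A i)).
  by apply; exact: (integrable_indic P (mA i)).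
rewrite -lee_fin -sumEFin.
have -> : \sum_(i <- s) (c i * pr (A i))%:E =
    (\int[P]_w (\sum_(i <- s) (c i * \1_(A i) w)%:E))%E.
  rewrite integral_sum//; apply: eq_bigr => i _.
  have intI : P.-integrable setT (fun w => (\1_(A i) w)%:E).
    exact: (integrable_indic P (mA i)).
  under [RHS]eq_integral do rewrite EFinM.
  by rewrite integralZl// integral_indic// setIT EFinM -prK.
by apply: integral_ge0 => w _; rewrite sumEFin lee_fin.
Qed.

Lemma pr_tail_lt Y (eta : R) : measurable_fun setT Y -> 0 < eta ->
  exists M : nat, forall c, M%:R <= c -> pr [set w | c < `|Y w|] < eta.
Proof.
move=> mY eta0; pose F (n : nat) := [set w | n%:R < `|Y w|].
have mF n : measurable (F n) by exact: measurable_gts_norm.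
have F0 : \bigcap_n F n = set0.
  rewrite -subset0 => w /(_ (Num.bound `|Y w|) I).
  by rewrite /F/= ltNge => /negP; apply; rewrite ltW// archi_boundP.
have cvgF : P (F n) @[n --> \oo] --> 0%E.
  rewrite -(measure0 P) -F0; apply: nonincreasing_cvg_mu => //.
  - by rewrite (le_lt_trans (probability_le1 _ _)) ?ltry.
  - exact: bigcap_measurable.
  - move=> m n mn; apply/subsetPset => w; rewrite /F/=.
    by apply: le_lt_trans; rewrite ler_nat.
have /fine_cvgP[_ /cvgrPdist_lt/(_ _ eta0)[M _ HM]] := cvgF.
exists M => c Mc; apply: le_lt_trans (HM M (leqnn M)).
rewrite /= sub0r normrN ger0_norm ?pr_ge0//; apply: le_pr => //.
- exact: measurable_gts_norm.
- by move=> w; apply: le_lt_trans.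
Qed.

Lemma pr_gt_right_limit Y (x a : R) : measurable_fun setT Y ->
  (forall e, 0 < e -> pr [set w | x + e < Y w] <= a) ->
  pr [set w | x < Y w] <= a.
Proof.
move=> mY Ya; pose F (n : nat) := [set w | x + n.+1%:R^-1 < Y w].
have mF n : measurable (F n) by exact: measurable_lts.
have UF : \bigcup_n F n = [set w | x < Y w].
  apply/seteqP; split => [w [n _]|w /= /ltr_add_invr[n xY]]; last by exists n.
  by apply: lt_trans; rewrite ltrDl invr_gt0.
have mU : measurable (\bigcup_n F n) by exact: bigcup_measurable.
rewrite -UF -lee_fin -prK//.
have cvgF : P (F n) @[n --> \oo] --> P (\bigcup_n F n).
  apply: nondecreasing_cvg_mu => // m n mn; apply/subsetPset => w.
  by apply: le_lt_trans; rewrite lerD2l lef_pV2 ?posrE// ler_nat.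
rewrite -(cvg_lim _ cvgF)//; apply: lime_le.
  by apply/cvg_ex; exists (P (\bigcup_n F n)).
by apply: nearW => n; rewrite (prK (mF n)) lee_fin Ya// invr_gt0.
Qed.

Lemma ae_pr0 (Q : T -> Prop) : measurable [set w | ~ Q w] ->
  {ae P, forall w, Q w} <-> pr [set w | ~ Q w] = 0.
Proof.
move=> mQ; have QP := negligibleP P mQ; split => [/QP|Q0].
  by rewrite /= => ->.
by apply: (proj2 QP); apply: (etrans (prK mQ)); rewrite Q0.
Qed.

Lemma ae_not (Q : T -> Prop) : measurable [set w | Q w] ->
  pr [set w | Q w] = 0 -> {ae P, forall w, ~ Q w}.
Proof.
move=> mQ Q0; exists [set w | Q w]; split => //; first by rewrite (prK mQ) Q0.
by move=> w /contrapT.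
Qed.

Lemma le_pr_ae A B : measurable A -> measurable B ->
  {ae P, forall w, A w -> B w} -> pr A <= pr B.
Proof.
move=> mA mB AB.
have CE : [set w | ~ (A w -> B w)] = A `\` B.
  by apply/seteqP; split => w /=; rewrite not_implyE.
have mC : measurable (A `\` B) by exact: measurableD.
have C0 : pr (A `\` B) = 0.
  by rewrite -CE; apply/ae_pr0 => //; rewrite CE.
rewrite -[leRHS]addr0 -C0; apply: le_pr_setU => // w Aw.
by have [|] := pselect (B w); [left|right].
Qed.

Lemma le_pr_setU_ae A B C : measurable A -> measurable B -> measurable C ->
  {ae P, forall w, A w -> B w \/ C w} -> pr A <= pr B + pr C.
Proof.
move=> mA mB mC ABC; have mBC := measurableU _ _ mB mC.
exact: le_trans (le_pr_ae mA mBC ABC) (le_pr_setU mBC mB mC (fun _ => id)).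
Qed.

Lemma eq_P_ae A B : measurable A -> measurable B ->
  {ae P, forall w, A w <-> B w} -> P A = P B.
Proof.
move=> mA mB AB; rewrite (prK mA) (prK mB); congr EFin; apply/le_anti/andP.
by split; apply: le_pr_ae => //; apply: filterS AB => w [].
Qed.

End Probability.

(** * Equality in distribution *)

Section EqualityInDistribution.
Context {d : measure_display} {T : measurableType d} {R : realType}.
Variable P : probability T R.
Implicit Types (A : set T) (Y Z : T -> R).

Local Notation pr A := (fine (P A)).

(** The rays [`]x, +oo[] form a pi-system that generates the Borel sets. *)
Lemma eq_distr_gt Y Z : measurable_fun setT Y -> measurable_fun setT Z ->
  (forall x, P [set w | x < Y w] = P [set w | x < Z w]) -> eq_distr P Y Z.
Proof.
move=> mY mZ YZ A mA.
pose Y' : {mfun T >-> R} := HB.pack Y (isMeasurableFun.Build _ _ _ _ _ mY).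
pose Z' : {mfun T >-> R} := HB.pack Z (isMeasurableFun.Build _ _ _ _ _ mZ).
pose g (k : nat) : set R := `]- k%:R, +oo[%classic.
rewrite -[LHS]/(distribution P Y' A) -[RHS]/(distribution P Z' A).
apply: (@measure_unique _ _ _ (@RGenOInfty.G R) g) => //.
- exact: RGenOInfty.measurableE.
- move=> _ _ [x ->] [y ->]; exists (Num.max x y).
  apply/seteqP; split => w /=; rewrite !in_itv/= !andbT gt_max.
    by case=> -> ->.
  by move=> /andP[].
- by move=> k; exists (- k%:R).
- rewrite -subTset => w _; exists (Num.bound `|w|) => //.
  rewrite /g/= in_itv/= andbT ltrNl; apply: le_lt_trans (archi_boundP _) => //.
  by rewrite ler_normr lexx orbT.
- move=> _ [x ->]; have := YZ x.
  by rewrite -!preimage_itvoy.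
- move=> k; have mg : measurable (Y @^-1` g k).
    by rewrite /g preimage_itvoy; exact: measurable_lts.
  have : (P (Y @^-1` g k) < +oo)%E by rewrite (prK P mg) ltry.
  exact.
Qed.

Lemma eq_distr_sym Y Z : eq_distr P Y Z -> eq_distr P Z Y.
Proof. by move=> YZ A mA; rewrite YZ. Qed.

Lemma eq_distr_trans Y Y' Z :
  eq_distr P Y Y' -> eq_distr P Y' Z -> eq_distr P Y Z.
Proof. by move=> YY' Y'Z A mA; rewrite YY'// Y'Z. Qed.

(** If copies of [Y] and [Z] can be coupled at arbitrarily small distance in
    probability, then [P (Y > x + e) <= P (Z > x) + eta] for all positive [e] and
    [eta], and right continuity of the tail gives [P (Y > x) <= P (Z > x)]. *)
Lemma eq_distr_limit Y Z : measurable_fun setT Y -> measurable_fun setT Z ->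
  (forall e eta, 0 < e -> 0 < eta -> exists Y' Z',
     [/\ measurable_fun setT Y', measurable_fun setT Z',
         eq_distr P Y Y', eq_distr P Z Z' &
         pr [set w | e < `|Y' w - Z' w|] < eta]) ->
  eq_distr P Y Z.
Proof.
suff le_gt Y1 Z1 : measurable_fun setT Y1 -> measurable_fun setT Z1 ->
  (forall e eta, 0 < e -> 0 < eta -> exists Y' Z',
     [/\ measurable_fun setT Y', measurable_fun setT Z',
         eq_distr P Y1 Y', eq_distr P Z1 Z' &
         pr [set w | e < `|Y' w - Z' w|] < eta]) ->
  forall x, pr [set w | x < Y1 w] <= pr [set w | x < Z1 w].
  move=> mY mZ YZ; apply: eq_distr_gt => // x.
  rewrite (prK P (measurable_lts (measurable_cst x) mY)).
  rewrite (prK P (measurable_lts (measurable_cst x) mZ)).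
  congr EFin; apply/le_anti/andP.
  split; apply: le_gt => // e eta e0 eta0.
  have [Y' [Z' [mY' mZ' YY' ZZ' YZ']]] := YZ _ _ e0 eta0.
  exists Z', Y'; split => //; congr (fine (P _) < _): YZ'.
  by apply/funext => w; rewrite /mkset distrC.
move=> mY mZ YZ x; apply: pr_gt_right_limit => // e e0.
apply/ler_addgt0Pr => eta eta0.
have [Y' [Z' [mY' mZ' YY' ZZ' YZ']]] := YZ _ _ e0 eta0.
have gtE (U U' : T -> R) y : eq_distr P U U' ->
    P [set w | y < U w] = P [set w | y < U' w].
  by move=> /(_ `]y, +oo[%classic (measurable_itv _)); rewrite !preimage_itvoy.
rewrite (gtE _ _ _ YY') (gtE _ _ _ ZZ').
apply: le_trans (lerD (lexx _) (ltW YZ')).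
apply: le_pr_setU.
- exact: measurable_lts.
- exact: measurable_lts.
- by apply: measurable_gts_norm; exact: measurable_funB.
- move=> w /= xY; have [xZ|Zx] := ltP x (Z' w); [by left|right].
  by rewrite ltr_normr; apply/orP; left; lra.
Qed.

Lemma eq_distr_ae Y Z : measurable_fun setT Y -> measurable_fun setT Z ->
  {ae P, forall w, Y w = Z w} -> eq_distr P Y Z.
Proof.
move=> mY mZ YZ A mA; apply: eq_P_ae.
- by have := mY measurableT _ mA; rewrite setTI.
- by have := mZ measurableT _ mA; rewrite setTI.
- by apply: filterS YZ => w; rewrite /preimage/= => ->.
Qed.

Lemma eq_distr_comp Y Z (f : R -> R) : measurable_fun setT f ->
  eq_distr P Y Z -> eq_distr P (f \o Y) (f \o Z).
Proof.
move=> mf YZ A mA; apply: (YZ (f @^-1` A)).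
by have := mf measurableT _ mA; rewrite setTI.
Qed.

Lemma eq_distr_norm_gt Y Z (e : R) : eq_distr P Y Z ->
  P [set w | e < `|Y w|] = P [set w | e < `|Z w|].
Proof.
move=> /(_ [set x | e < `|x|]); apply; exact: measurable_gts_norm.
Qed.

Lemma eq_distr_eq Y Z (x : R) : eq_distr P Y Z ->
  P [set w | Y w = x] = P [set w | Z w = x].
Proof. by move=> /(_ [set x]); apply; exact: measurable_set1. Qed.

Lemma eq_distr_expectation Y Z : measurable_fun setT Y -> measurable_fun setT Z ->
  eq_distr P Y Z -> ('E_P[Y] = 'E_P[Z])%E.
Proof.
move=> mY mZ YZ.
have ge0_eq (f : R -> \bar R) : measurable_fun setT f -> (forall x, 0 <= f x)%E ->
    (\int[P]_w f (Y w) = \int[P]_w f (Z w))%E.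
  move=> mf f0.
  have fY := ge0_integral_pushforward mY P measurableT mf (fun x _ => f0 x).
  have fZ := ge0_integral_pushforward mZ P measurableT mf (fun x _ => f0 x).
  rewrite !preimage_setT in fY fZ.
  rewrite -[LHS]fY -[RHS]fZ; apply: eq_measure_integral => A mA _.
  exact: YZ.
have mE : measurable_fun setT (@EFin R) by exact/measurable_EFinP.
have posE (V : T -> R) :
    (fun w => (V w)%:E)^\+%E = (fun w => (EFin^\+)%E (V w)).
  by apply/funext => w; rewrite !funeposE.
have negE (V : T -> R) :
    (fun w => (V w)%:E)^\-%E = (fun w => (EFin^\-)%E (V w)).
  by apply/funext => w; rewrite !funenegE.
rewrite unlock integralE [RHS]integralE !posE !negE; congr (_ - _)%E.
- exact: (ge0_eq _ (measurable_funepos mE) (funepos_ge0 _)).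
- exact: (ge0_eq _ (measurable_funeneg mE) (funeneg_ge0 _)).
Qed.

Lemma eq_distr_variance Y Z : measurable_fun setT Y -> measurable_fun setT Z ->
  eq_distr P Y Z -> variance P Y = variance P Z.
Proof.
move=> mY mZ YZ; rewrite /variance unlock.
rewrite -(eq_distr_expectation mY mZ YZ); set m := fine _.
pose f (y : R) := (y - m) * (y - m).
have mf : measurable_fun setT f.
  by apply: measurable_funM; apply: measurable_funB.
rewrite -[(Y \- _) * _]/(f \o Y) -[(Z \- _) * _]/(f \o Z).
apply: eq_distr_expectation; [exact: measurableT_comp..|].
exact: eq_distr_comp.
Qed.

Lemma Lfun2_sqr_finite Y : measurable_fun setT Y ->
  ('E_P[fun w => (Y w ^+ 2)%R] < +oo)%E -> Y \in Lfun P 2%:E.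
Proof.
move=> mY; rewrite unlock => Y2; rewrite inE; apply/andP; split; rewrite inE//=.
rewrite /finite_norm unlock/=; apply: poweR_lty.
apply: le_lt_trans Y2; rewrite le_eqVlt; apply/orP; left; apply/eqP.
apply: eq_integral => w _ /=.
by rewrite powR_mulrn// real_normK// num_real.
Qed.

Lemma eq_distr_Lfun2 Y Z : measurable_fun setT Y -> measurable_fun setT Z ->
  eq_distr P Y Z -> Z \in Lfun P 2%:E -> Y \in Lfun P 2%:E.
Proof.
move=> mY mZ YZ /Lfun2_integrable_sqr/integrableP[_ Z2].
apply: Lfun2_sqr_finite => //.
have mf : measurable_fun setT (fun y : R => y ^+ 2) by exact: measurable_funX.
have YZ2 := eq_distr_comp mf YZ.
have mY2 := measurableT_comp mf mY; have mZ2 := measurableT_comp mf mZ.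
have -> := eq_distr_expectation mY2 mZ2 YZ2; rewrite unlock.
apply: le_lt_trans Z2; rewrite le_eqVlt; apply/orP; left; apply/eqP.
by apply: eq_integral => w _ /=; rewrite ger0_norm// sqr_ge0.
Qed.

Lemma variance_scale Y Z (t : R) : measurable_fun setT Y ->
  measurable_fun setT Z -> Z \in Lfun P 2%:E ->
  eq_distr P Y (fun w => t * Z w) ->
  variance P Y = ((t ^+ 2)%:E * variance P Z)%E.
Proof.
move=> mY mZ Z2 YZ; rewrite -varianceZ//; apply: eq_distr_variance => //.
  exact: measurable_funM.
rewrite (_ : t \o* Z = (fun w => t * Z w))//.
by apply/funext => w /=; rewrite mulrC.
Qed.

End EqualityInDistribution.

(** * Tails and coincidence kernels *)

Lemma pr_geometric_lt d (T : measurableType d) (R : realType)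
    (P : probability T R) (Y : T -> R) (r e eta : R) :
  measurable_fun setT Y -> 0 < r -> r < 1 -> 0 < e -> 0 < eta ->
  exists k : nat, forall j, (k <= j)%N ->
    fine (P [set w | e < `|r ^+ j * Y w|]) < eta.
Proof.
move=> mY r0 r1 e0 eta0; have [M HM] := pr_tail_lt P mY eta0.
have : (fun j => r ^+ j) @ \oo --> (0 : R).
  by apply: cvg_expr; rewrite ger0_norm ?ltW.
have eM0 : 0 < e / (M.+1)%:R by rewrite divr_gt0.
move=> /cvgrPdist_lt/(_ _ eM0)[k _ Hk]; exists k => j kj.
have rj0 : 0 < r ^+ j by rewrite exprn_gt0.
have {}Hk : r ^+ j < e / M.+1%:R.
  by have := Hk _ kj; rewrite /= sub0r normrN gtr0_norm.
have MC : M%:R <= e / r ^+ j.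
  rewrite ler_pdivlMr//; apply: ltW; apply: (@le_lt_trans _ _ (M.+1%:R * r ^+ j)).
    by rewrite ler_pM2r// ler_nat.
  by rewrite mulrC -ltr_pdivlMr// ltr0n.
apply: le_lt_trans (HM _ MC); apply: le_pr.
- by apply: measurable_gts_norm; exact: measurable_funM.
- exact: measurable_gts_norm.
- by move=> w /=; rewrite normrM gtr0_norm// ltr_pdivrMr// mulrC.
Qed.

(** Coincidence probabilities restricted to an event form a positive
    semidefinite kernel, since they are averages of [gram_indicator_ge0]. *)
Lemma coincidence_gram_ge0 d (T : measurableType d) (R : realType)
    (P : probability T R) (Y : nat -> T -> R) (E : set T) (s : seq (R * nat)) :
  measurable E -> (forall n, measurable_fun setT (Y n)) ->
  0 <= \sum_(x <- s) \sum_(y <- s)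
         x.1 * y.1 * fine (P (E `&` [set w | Y x.2 w = Y y.2 w])).
Proof.
move=> mE mY.
pose A (xy : (R * nat) * (R * nat)) :=
  E `&` [set w | Y xy.1.2 w = Y xy.2.2 w].
have pairsE (F : (R * nat) * (R * nat) -> R) :
    \sum_(x <- s) \sum_(y <- s) F (x, y) =
    \sum_(xy <- [seq (x, y) | x <- s, y <- s]) F xy.
  by rewrite big_allpairs.
rewrite (pairsE (fun xy => xy.1.1 * xy.2.1 * fine (P (A xy)))).
apply: sum_pr_ge0 => [xy|w].
  by apply: measurableI => //; exact: measurable_eqs.
rewrite -(pairsE (fun xy => xy.1.1 * xy.2.1 * \1_(A xy) w))/=.
have [Ew|nEw] := pselect (E w); last first.
  rewrite big1// => x _; rewrite big1// => y _.
  by rewrite indicE memNset ?mulr0// => -[].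
apply: le_trans (gram_indicator_ge0 s fst (fun x => Y x.2 w)) _.
rewrite le_eqVlt; apply/orP; left; apply/eqP.
apply: eq_bigr => x _; apply: eq_bigr => y _; congr (_ * _%:R).
rewrite /A/=; have [e|ne] := eqVneq (Y x.2 w) (Y y.2 w).
  by rewrite mem_set.
by rewrite memNset// => -[_ /eqP]; exact/negP.
Qed.

(** * The scaling factor *)

Section PadicNorm.
Context {R : realType} (p : nat) (H : R).
Hypotheses (p_prime : prime p) (H_gt0 : 0 < H).

(** The factor by which a dilation by [p] scales the process: [|p|_p `^ H]. *)
Definition padic_ratio : R := p%:R `^ (- H).

Lemma padic_ratio_gt0 : 0 < padic_ratio.
Proof. by rewrite powR_gt0// ltr0n prime_gt0. Qed.

Lemma padic_ratio_lt1 : padic_ratio < 1.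
Proof.
rewrite /padic_ratio powRN invf_lt1 ?powR_gt0 ?ltr0n ?prime_gt0//.
have : 1 `^ H < (p%:R : R) `^ H.
  by apply: gt0_ltr_powR; rewrite ?nnegrE ?ltr1n ?prime_gt1.
by rewrite powR1.
Qed.

Lemma padic_norm_powR n : (0 < n)%N ->
  padic_norm R p n%:Z `^ H = padic_ratio ^+ logn p n.
Proof.
move=> n0; rewrite /padic_norm.
have -> : (n%:Z == 0 :> int) = false by case: n n0.
rewrite absz_nat; set l := logn p n.
rewrite -(powR_invn l (ler0n R p)) -(powR_mulrn l (powR_ge0 _ _)).
by rewrite /padic_ratio -!powRrM mulNr mulrC mulNr.
Qed.

Lemma padic_norm_sqr (z : int) :
  padic_norm R p z `^ (2 * H) = (padic_norm R p z `^ H) ^+ 2.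
Proof. by rewrite mulrC powRrM powR_mulrn// powR_ge0. Qed.

Lemma padic_norm_abs (z : int) : padic_norm R p z = padic_norm R p `|z|%N.
Proof. by rewrite /padic_norm absz_id -[in RHS]absz_eq0 absz_id absz_eq0. Qed.

Lemma padic_norm0_powR : padic_norm R p 0 `^ H = 0.
Proof. by rewrite /padic_norm eqxx powR0 ?gt_eqF. Qed.

End PadicNorm.

(** * Consequences of scaling and stationarity *)

Section PathSpace.
Context {R : realType}.

Lemma measurable_coordinate i :
  measurable_fun setT (fun u : path_space R => u i).
Proof.
move=> _ B mB; rewrite setTI; apply: sub_sigma_algebra.
by exists i; exists B.
Qed.

Context {d : measure_display} {T : measurableType d}.
Variable P : probability T R.

Lemma eq_distr_process_comp (Y Z : nat -> T -> R) (f : path_space R -> R) :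
  eq_distr_process P Y Z -> measurable_fun setT f ->
  eq_distr P (f \o sample_path Y) (f \o sample_path Z).
Proof.
move=> YZ mf A mA; apply: (YZ (f @^-1` A)).
by have := mf measurableT _ mA; rewrite setTI.
Qed.

End PathSpace.

Section Process.
Context {d : measure_display} {T : measurableType d} {R : realType}.
Variables (P : probability T R) (X : nat -> {RV P >-> R}) (p : nat) (H : R).
Hypotheses (p_prime : prime p) (H_gt0 : 0 < H).
Hypothesis X_ss_si : dt_ss_si X (fun n => padic_norm R p n%:Z `^ H).

Local Notation pr A := (fine (P A)).
Local Notation r := (padic_ratio p H).

Let r_gt0 : 0 < r. Proof. exact: padic_ratio_gt0. Qed.
Let r_lt1 : r < 1. Proof. exact: padic_ratio_lt1. Qed.

Let mX n : measurable_fun setT (X n). Proof. exact: measurable_funPT. Qed.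

Let mXB m n : measurable_fun setT (fun w => X m w - X n w).
Proof. exact: measurable_funB. Qed.

Lemma dilation_law n m : (0 < n)%N ->
  eq_distr P (X (n * m)%N) (fun w => r ^+ logn p n * X m w).
Proof.
move=> n0; have [_ /(_ n n0) ss _] := X_ss_si.
have := eq_distr_process_comp ss (measurable_coordinate m).
by rewrite padic_norm_powR.
Qed.

Lemma unit_law u : ~~ (p %| u)%N -> eq_distr P (X u) (X 1%N).
Proof.
move=> pu; have u0 : (0 < u)%N by case: u pu => //; rewrite dvdn0.
have := dilation_law 1 u0; rewrite muln1 lognE p_prime u0 (negbTE pu)/= expr0.
by under [X in eq_distr _ _ X]eq_fun do rewrite mul1r.
Qed.

Lemma unit_dilation_law u n m (e : R) : ~~ (p %| u)%N ->
  P [set w | X n w = 0 /\ e < `|X m w|] =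
  P [set w | X (u * n)%N w = 0 /\ e < `|X (u * m)%N w|].
Proof.
move=> pu; have u0 : (0 < u)%N by case: u pu => //; rewrite dvdn0.
have [_ /(_ u u0) ss _] := X_ss_si.
pose A := [set v : path_space R | v n = 0] `&`
          [set v : path_space R | e < `|v m|].
have mA : measurable A.
  apply: measurableI.
    by apply: measurable_eqs => //; exact: measurable_coordinate.
  by apply: measurable_gts_norm; exact: measurable_coordinate.
have := ss A mA; rewrite padic_norm_powR// lognE p_prime u0 (negbTE pu).
move=> /esym; rewrite expr0; congr (P _ = _).
by apply/seteqP; split => w; rewrite /A/sample_path/= !mul1r.
Qed.

(** The increments over [m] steps are partial sums of the one-step increments,
    and the partial sum is a measurable function of the path. *)
Lemma increment_law m k :
  eq_distr P (fun w => X (m + k)%N w - X k w) (fun w => X m w - X 0%N w).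
Proof.
case: k => [|k]; first by rewrite addn0.
have [_ _ /(_ k.+1 isT) si] := X_ss_si.
pose f (u : path_space R) : R := \sum_(i < m) u i.
have mf : measurable_fun setT f.
  by apply: measurable_sum => i; exact: measurable_coordinate.
have := eq_distr_process_comp si mf.
rewrite (_ : f \o _ = (fun w => X m w - X 0%N w)).
  rewrite (_ : f \o _ = (fun w => X (m + k.+1)%N w - X k.+1 w)).
    exact: eq_distr_sym.
  apply/funext => w; rewrite /f/=/sample_path.
  rewrite -(big_mkord xpredT (fun i => X (i + k.+1).+1 w - X (i + k.+1)%N w)).
  by rewrite (telescope_sumr (fun i => X (i + k.+1)%N w)).
apply/funext => w; rewrite /f/=/sample_path.
rewrite -(big_mkord xpredT (fun i => X i.+1 w - X i w)).
by rewrite (telescope_sumr (fun i => X i w)).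
Qed.

(** [X 0] has the law of [padic_ratio ^+ k * X 0] for every [k], and the latter
    tends to [0]. *)
Lemma X0_ae : {ae P, forall w, X 0%N w = 0}.
Proof.
suff X0 (n : nat) : {ae P, forall w, ~ (n.+1%:R^-1 < `|X 0%N w|)}.
  have := ae_foralln X0; apply: filterS => w Xw.
  apply/eqP; rewrite -normr_le0 leNgt; apply/negP => /ltr_add_invr[n].
  by rewrite add0r => /Xw.
apply: ae_not; first exact: measurable_gts_norm.
apply/le_anti; rewrite pr_ge0 andbT.
apply/ler_addgt0Pr => eta eta0; rewrite add0r.
have e0 : 0 < n.+1%:R^-1 :> R by rewrite invr_gt0.
have [k Hk] := pr_geometric_lt P (mX 0) r_gt0 r_lt1 e0 eta0.
have pk0 : (0 < p ^ k)%N by rewrite expn_gt0 prime_gt0.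
have := dilation_law 0 pk0; rewrite muln0 pfactorK// => /eq_distr_norm_gt ->.
exact/ltW/Hk.
Qed.

Let mN : measurable_fun setT (-%R : R -> R).
Proof. exact: oppr_measurable. Qed.

(* The paths are continuous in probability for the [p]-adic topology; the bound
   is uniform over the multiples of [p ^ k]. *)
Let small_multiple (e eta : R) : 0 < e -> 0 < eta ->
  exists k, forall n, (0 < n)%N -> (p ^ k %| n)%N ->
    pr [set w | e < `|X n w|] < eta.
Proof.
move=> e0 eta0; have [k Hk] := pr_geometric_lt P (mX 1) r_gt0 r_lt1 e0 eta0.
exists k => n n0 kn; have := dilation_law 1 n0; rewrite muln1.
by move=> /eq_distr_norm_gt ->; apply: Hk; rewrite -pfactor_dvdn.
Qed.

Lemma stationary_law m k :
  eq_distr P (fun w => X (m + k)%N w - X k w) (X m).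
Proof.
apply: eq_distr_trans (increment_law m k) _; apply: eq_distr_ae => //.
by apply: filterS X0_ae => w ->; rewrite subr0.
Qed.

Lemma one_dim_law n :
  eq_distr P (X n) (fun w => padic_norm R p n `^ H * X 1%N w).
Proof.
have [->|n0] := posnP n; last first.
  by rewrite padic_norm_powR//; have := dilation_law 1 n0; rewrite muln1.
rewrite padic_norm0_powR//; apply: eq_distr_ae => //.
  exact: measurable_funM.
by apply: filterS X0_ae => w ->; rewrite mul0r.
Qed.

Let small_increment m (e eta : R) : 0 < e -> 0 < eta ->
  exists k, forall n, (0 < n)%N -> (p ^ k %| n)%N ->
    pr [set w | e < `|X (n + m)%N w - X m w|] < eta.
Proof.
move=> e0 eta0; have [k Hk] := small_multiple e0 eta0; exists k => n n0 kn.
by rewrite (eq_distr_norm_gt e (stationary_law n m)); exact: Hk.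
Qed.

(** [X (p ^ k + n) - X n] has the law of [X (p ^ k)], so it tends to [0] in
    probability. Hence for each threshold almost surely infinitely many of these
    differences are below it. *)
Lemma recurrent_ae n :
  {ae P, forall w, seq_limit_point (fun k => X k w) (X n w)}.
Proof.
(* [j] fixes the threshold [1 / (j + 1)], and [N] the rank from which the
   differences are taken. *)
suff rec (N j : nat) : {ae P, forall w, ~ forall i,
    j.+1%:R^-1 < `|X (p ^ (N + i) + n)%N w - X n w|}.
  have := ae_foralln (fun N => ae_foralln (rec N)); apply: filterS => w Xw.
  apply/cluster_eventually_cvg/cluster_eventuallyP => e N e0.
  have := Xw N (Num.bound e^-1) => /existsNP[i /negP]; rewrite -leNgt => Xi.
  exists (p ^ (N + i) + n)%N.
    apply: leq_trans (leq_addr _ _); apply: leq_trans (leq_addr i _) _.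
    by rewrite ltnW// ltn_expl// prime_gt1.
  rewrite distrC; apply: le_trans Xi _; rewrite invf_ple ?posrE//.
  apply: le_trans (ltW (archi_boundP _)) _; first by rewrite invr_ge0 ltW.
  by rewrite ler_nat.
pose A i := [set w | j.+1%:R^-1 < `|X (p ^ (N + i) + n)%N w - X n w|].
have mA i : measurable (A i) by apply: measurable_gts_norm.
have mIA : measurable (\bigcap_i A i) by exact: bigcapT_measurable.
exists (\bigcap_i A i); split => //; last first.
  by move=> w /contrapT Xw i _; exact: Xw.
rewrite (prK P mIA); congr EFin; apply/le_anti; rewrite pr_ge0 andbT.
apply/ler_addgt0Pr => eta eta0; rewrite add0r.
have e0 : 0 < j.+1%:R^-1 :> R by rewrite invr_gt0.
have [k Hk] := small_increment n e0 eta0.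
have Ak : pr (A k) < eta.
  by apply: Hk; rewrite ?expn_gt0 ?prime_gt0// dvdn_exp2l// leq_addl.
by apply: le_trans (ltW Ak); apply: le_pr => //; apply: bigcap_inf.
Qed.

(** With [n = p ^ k - 1], a number prime to [p], both [X n] and [X (n + 1) - X n]
    have the law of [X 1], while their sum [X (p ^ k)] is close to [0]. *)
Lemma symmetric_law : eq_distr P (X 1%N) (fun w => - X 1%N w).
Proof.
apply: eq_distr_limit => // [|e eta e0 eta0]; first exact: measurableT_comp.
have [k Hk] := small_multiple e0 eta0.
pose n := (p ^ k.+1).-1.
have pk1 : (1 < p ^ k.+1)%N by rewrite -{1}(expn0 p) ltn_exp2l// prime_gt1.
have nS : n.+1 = (p ^ k.+1)%N by rewrite prednK// ltnW.
have n0 : (0 < n)%N by rewrite -ltnS nS.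
have pn : ~~ (p %| n)%N.
  apply/negP => pn; have : (p %| n.+1)%N by rewrite nS dvdn_exp.
  by rewrite -addn1 dvdn_addr// dvdn1 gtn_eqF// prime_gt1.
exists (X n), (fun w => - (X (1 + n)%N w - X n w)); split => //.
- exact: measurableT_comp.
- by apply: eq_distr_sym; exact: unit_law.
- apply: eq_distr_sym.
  have := eq_distr_comp mN (stationary_law 1 n). exact.
- rewrite (_ : [set w | _] = [set w | e < `|X (p ^ k.+1)%N w|]).
    by apply: Hk; rewrite ?expn_gt0 ?prime_gt0// dvdn_exp2l.
  apply/funext => w; rewrite /mkset opprK addrC add1n nS.
  by rewrite subrK.
Qed.

Lemma expectation_eq0 : ('E_P[fun w => `|X 1%N w|%R] < +oo)%E ->
  forall n : nat, ('E_P[X n] = 0)%E.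
Proof.
move=> X1oo n.
have X1 : (X 1%N : T -> R) \in Lfun P 1.
  apply/Lfun1_integrable/integrableP; split; first exact/measurable_EFinP.
  by rewrite unlock in X1oo.
have E1 : ('E_P[X 1%N] = 0)%E.
  have mNX1 := measurableT_comp mN (mX 1).
  have NX1 := eq_distr_expectation (mX 1) mNX1 symmetric_law.
  have := expectationZl (-1) X1.
  rewrite (_ : -1 \o* X 1%N = (fun w => - X 1%N w)); last first.
    by apply/funext => w /=; rewrite mulrN1.
  rewrite -NX1; move: (expectation_fin_num X1).
  by case: ('E_P[X 1%N])%E => // a _; rewrite -EFinM => -[aN]; congr EFin; lra.
rewrite (eq_distr_expectation (mX n) _ (one_dim_law n)).
  rewrite (_ : (fun w => _) = (padic_norm R p n `^ H) \o* X 1%N).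
    by rewrite expectationZl// E1 mule0.
  by apply/funext => w /=; rewrite mulrC.
exact: measurable_funM.
Qed.

(** * Coincidences *)

(* The probability of coincidence of any two distinct times. *)
Let q := pr [set w | X 1%N w = 0].

Let m0 n : measurable [set w | X n w = 0].
Proof. exact: measurable_eqs. Qed.

Let mE m n : measurable [set w | X m w = X n w].
Proof. exact: measurable_eqs. Qed.

Lemma pr_zero n : (0 < n)%N -> pr [set w | X n w = 0] = q.
Proof.
move=> n0; have := dilation_law 1 n0; rewrite muln1 => /eq_distr_eq ->.
congr (fine (P _)); apply/seteqP; split => w /=.
  by move/eqP; rewrite mulf_eq0 expf_eq0 (gt_eqF r_gt0) andbF => /eqP.
by move->; rewrite mulr0.
Qed.

Lemma pr_coincide m n : m != n -> pr [set w | X m w = X n w] = q.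
Proof.
wlog mn : m n / (m < n)%N.
  move=> th; case: ltngtP => // [mn|nm] _.
    by apply: th => //; rewrite ltn_eqF.
  rewrite -(th n m nm) ?ltn_eqF//.
  by congr (fine (P _)); apply/seteqP; split => w /=.
move=> _; rewrite -(@pr_zero (n - m)%N) ?subn_gt0//.
have := eq_distr_eq 0 (stationary_law (n - m) m); rewrite subnK 1?ltnW// => <-.
congr (fine (P _)); apply/seteqP; split => w /=.
  by move->; rewrite subrr.
by move/eqP; rewrite subr_eq0 => /eqP.
Qed.

Let q_le1 : q <= 1.
Proof. by rewrite -lee_fin -(prK P (m0 1)) probability_le1. Qed.

Lemma pr_coincide_itv m n : q <= pr [set w | X m w = X n w] <= q + (m == n)%:R.
Proof.
have [<-|mn] := eqVneq m n; last by rewrite pr_coincide// addr0 lexx.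
rewrite (_ : [set w | _] = setT) ?probability_setT/=.
  by rewrite q_le1 lerDr pr_ge0.
by apply/seteqP; split.
Qed.

(** Put the mass [M] at [0], the mass [1] at each [a i] and [-1] at each [b i].
    The coincidence form on [E] is nonnegative at this measure, and the one on
    the complement of [E] is nonnegative at the measure without its mass at [0].
    The sum of the two values contains the form of the total probability at the
    latter measure; distinct times coincide with the constant probability [q],
    so this part is at most [2 N], coming from the diagonal terms. The number
    [N = M ^ 2] of points balances [2 N] against the contribution [M ^ 2] of the
    mass at [0]; after division by [N] the error is of order [1 / M]: on [E] the
    value of time [0] recurs nearly equally often at [a i] and at [b i]. *)
Lemma coincidence_sum_le (E : set T) (a b : nat -> nat) (M : nat) :
  measurable E -> injective a -> injective b -> (0 < M)%N ->
  2 * \sum_(i < M ^ 2) pr (E `&` [set w | X 0%N w = X (b i) w]) <=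
  2 * \sum_(i < M ^ 2) pr (E `&` [set w | X 0%N w = X (a i) w]) + 3 * M%:R.
Proof.
move=> mE' a_inj b_inj M0.
pose K A i j := pr (A `&` [set w | X i w = X j w]).
have KC A i j : K A i j = K A j i.
  by congr (fine (P (_ `&` _))); apply/seteqP; split => w.
pose s c : seq (R * nat) := (c, 0%N) :: [seq (1, a i) | i <- iota 0 (M ^ 2)] ++
  [seq (-1, b i) | i <- iota 0 (M ^ 2)].
have := coincidence_gram_ge0 P (s M%:R) mE' mX.
rewrite (gram_three_blocks (K E)).
have := coincidence_gram_ge0 P (s 0) (measurableC mE') mX.
rewrite (gram_three_blocks (K (~` E))).
rewrite expr0n/= !mul0r !add0r.
set QC := \sum_(i < M ^ 2) _; set S1 := \sum_(i < M ^ 2) _.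
set S2 := \sum_(i < M ^ 2) _; set S3 := \sum_(i < M ^ 2) _.
set S4 := \sum_(i < M ^ 2) _; set Q := \sum_(i < M ^ 2) _.
have -> : S3 = S1 by apply: eq_bigr => i _; exact: KC.
have -> : S4 = S2 by apply: eq_bigr => i _; exact: KC.
have QQ : Q + QC <= 2 * M%:R ^+ 2.
  have -> : Q + QC = \sum_(i < M ^ 2) \sum_(j < M ^ 2)
      (pr [set w | X (a i) w = X (a j) w] + pr [set w | X (b i) w = X (b j) w]
       - pr [set w | X (a i) w = X (b j) w] - pr [set w | X (b i) w = X (a j) w]).
    rewrite -big_split; apply: eq_bigr => i _.
    rewrite -big_split; apply: eq_bigr => j _.
    rewrite (pr_splitI P mE' (mE (a i) (a j))) (pr_splitI P mE' (mE (b i) (b j))).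
    rewrite (pr_splitI P mE' (mE (a i) (b j))) (pr_splitI P mE' (mE (b i) (a j))).
    by rewrite /K/=; ring.
  apply: (@le_trans _ _ (\sum_(i < M ^ 2) 2)); last first.
    by rewrite sumr_const card_ord -[leLHS]mulr_natr natrX.
  apply: ler_sum => i _.
  apply: (@le_trans _ _ (\sum_(j < M ^ 2) (2 * (i == j)%:R))).
    apply: ler_sum => j _.
    have /andP[_ aa] := pr_coincide_itv (a i) (a j).
    have /andP[_ bb] := pr_coincide_itv (b i) (b j).
    have /andP[ab _] := pr_coincide_itv (a i) (b j).
    have /andP[ba _] := pr_coincide_itv (b i) (a j).
    rewrite (inj_eq a_inj) in aa; rewrite (inj_eq b_inj) in bb.
    rewrite -val_eqE/=; lra.
  rewrite -mulr_sumr (bigD1 i)//= eqxx big1 ?addr0 ?mulr1// => j ji.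
  by rewrite eq_sym (negbTE ji).
have K1 : K E 0%N 0%N <= 1.
  have mK := measurableI _ _ mE' (mE 0 0).
  by rewrite -lee_fin -(prK P mK) probability_le1.
move=> QC0 Q0.
have M0' : 0 < M%:R :> R by rewrite ltr0n.
rewrite -(ler_pM2l M0').
have MK : M%:R ^+ 2 * K E 0%N 0%N <= M%:R ^+ 2 by rewrite ler_piMr// sqr_ge0.
rewrite -/S1 -/S2; nra.
Qed.

(** Dilating by units [u i] close to [1] moves [n] to distinct times [u i * n]
    and [m] to times [u i * m] whose values are close to [X m]. On the event [E]
    that [X m] is away from [0], the path is therefore rarely zero at the times
    [u i * m]; by [coincidence_sum_le] it is rarely zero at the times [u i * n]
    either. But the probability that the path is zero at [u i * n] and away from
    [0] at [u i * m] does not depend on [i], because dilations by units preserve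
    the law. *)
Lemma pr_zero_gt n m (e : R) : (0 < n)%N -> (0 < m)%N -> 0 < e ->
  pr [set w | X n w = 0 /\ e < `|X m w|] = 0.
Proof.
move=> n0 m_gt0 e0; apply/le_anti; rewrite pr_ge0 andbT.
apply/ler_addgt0Pr => delta delta0; rewrite add0r.
pose M := (Num.bound (3 / delta)).+1.
have M0 : 0 < M%:R :> R by rewrite ltr0n.
have MB : 3 / delta <= M%:R.
  apply: le_trans (ltW (archi_boundP _)) _; last by rewrite ler_nat.
  by rewrite divr_ge0// ltW.
have e20 : 0 < e / 2 by rewrite divr_gt0.
have eta0 : 0 < delta / 4 by rewrite divr_gt0.
have [k Hk] := small_increment m e20 eta0.
pose u i := (p ^ k.+1 * i.+1 + 1)%N.
have u_inj : injective u.
  by move=> i j /addIn/eqP; rewrite eqn_pmul2l ?expn_gt0 ?prime_gt0// => /eqP[].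
have pu i : ~~ (p %| u i)%N.
  by rewrite /u dvdn_addr ?dvdn1 ?gtn_eqF ?prime_gt1// dvdn_mulr// dvdn_exp.
pose E := [set w | e / 2 < `|X m w|].
have mE' : measurable E by exact: measurable_gts_norm.
pose D i := [set w | e / 2 < `|X (u i * m)%N w - X m w|].
have mD i : measurable (D i) by exact: measurable_gts_norm.
have prD i : pr (D i) < delta / 4.
  rewrite /D /u mulnDl mul1n; apply: Hk.
    by rewrite !muln_gt0 expn_gt0 prime_gt0.
  by rewrite expnS -!mulnA dvdn_mull// dvdn_mulr.
have mI l : measurable (E `&` [set w | X 0%N w = X l w]) by exact: measurableI.
have lo i : pr [set w | X n w = 0 /\ e < `|X m w|] <=
    pr (E `&` [set w | X 0%N w = X (u i * n)%N w]) + delta / 4.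
  rewrite (unit_dilation_law _ _ _ (pu i)).
  apply: le_trans (lerD (lexx _) (ltW (prD i))).
  apply: le_pr_setU_ae => //.
    exact: measurableI (m0 _) (measurable_gts_norm e (mX _)).
  apply: filterS X0_ae => w Xw [Xn Xm]; have [Em|Em] := ltP (e / 2) `|X m w|.
    by left; split => //=; rewrite Xw Xn.
  right; rewrite /D/=.
  have := ler_normB (X (u i * m)%N w - X m w) (- X m w).
  by rewrite opprK subrK normrN => tri; lra.
have hi i : pr (E `&` [set w | X 0%N w = X (u i * m)%N w]) <= delta / 4.
  apply: le_trans (ltW (prD i)); apply: le_pr_ae => //.
  apply: filterS X0_ae => w Xw [Em /= Xm]; rewrite /D/= -Xm Xw sub0r normrN.
  exact: Em.
have inj_mul l : (0 < l)%N -> injective (fun i => (u i * l)%N).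
  by move=> l0 i j /eqP; rewrite eqn_pmul2r// => /eqP/u_inj.
have M_gt0 : (0 < M)%N by [].
have := coincidence_sum_le mE' (inj_mul m m_gt0) (inj_mul n n0) M_gt0.
set S2 := \sum_(i < _) _; set S1 := \sum_(i < _) _ => S12.
set alpha := pr _ in lo *.
have S1le : S1 <= M%:R ^+ 2 * (delta / 4).
  apply: (@le_trans _ _ (\sum_(i < M ^ 2) (delta / 4))).
    by apply: ler_sum => i _; exact: hi.
  by rewrite sumr_const card_ord -[leLHS]mulr_natl natrX.
have S2ge : M%:R ^+ 2 * (alpha - delta / 4) <= S2.
  apply: (@le_trans _ _ (\sum_(i < M ^ 2) (alpha - delta / 4))).
    by rewrite sumr_const card_ord -[leRHS]mulr_natl natrX.
  by apply: ler_sum => i _; rewrite lerBlDr; exact: lo.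
have M3 : 3 <= delta * M%:R by rewrite mulrC -ler_pdivrMr.
rewrite -(ler_pM2l M0) -(ler_pM2l M0); nra.
Qed.

Let m_all0 : measurable [set w | forall i, X i w = 0].
Proof.
rewrite (_ : [set w | _] = \bigcap_i [set w | X i w = 0]).
  exact: bigcapT_measurable.
by apply/seteqP; split => [w Xw i _|w Xw i]; [exact: Xw|exact: Xw].
Qed.

Lemma zero_everywhere n : (0 < n)%N ->
  {ae P, forall w, X n w = 0 -> forall i, X i w = 0}.
Proof.
move=> n0.
have Xe i j : {ae P, forall w,
    ~ (X n w = 0 /\ j.+1%:R^-1 < `|X i.+1 w|)}.
  apply: ae_not; last by apply: pr_zero_gt => //; rewrite invr_gt0.
  exact: measurableI (m0 _) (measurable_gts_norm _ (mX _)).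
have := ae_foralln (fun i => ae_foralln (Xe i)).
apply: filterS2 X0_ae => w X0w Xw Xn [//|i].
apply/eqP; rewrite -normr_le0 leNgt; apply/negP => /ltr_add_invr[j].
by rewrite add0r => Xi; apply: (Xw i j).
Qed.

Lemma P_all_zero n : (0 < n)%N ->
  P [set w | X n w = 0] = P [set w | forall i, X i w = 0].
Proof.
move=> n0; apply: eq_P_ae => //; apply: filterS (zero_everywhere n0) => w Xw.
by split => //; apply.
Qed.

Lemma P_coincide m n : m <> n ->
  P [set w | X m w = X n w] = P [set w | X m w = 0 /\ X n w = 0] /\
  P [set w | X m w = 0 /\ X n w = 0] = P [set w | forall i, X i w = 0].
Proof.
move=> /eqP mn.
have both0 : P [set w | X m w = 0 /\ X n w = 0] =
    P [set w | forall i, X i w = 0].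
  apply: eq_P_ae => //; first exact: measurableI (m0 m) (m0 n).
  have [k k0 kmn] : exists2 k, (0 < k)%N & k = m \/ k = n.
    case: (posnP m) mn => [->|m_gt0 _]; last by exists m => //; left.
    by rewrite eq_sym -lt0n => n_gt0; exists n => //; right.
  apply: filterS (zero_everywhere k0) => w Xw; split => [[Xm Xn]|Xi].
    by apply: Xw; case: kmn => ->.
  by split; exact: Xi.
split => //; rewrite both0 -(P_all_zero (ltn0Sn 0)).
by rewrite (prK P (mE m n)) (prK P (m0 1)) pr_coincide.
Qed.

Lemma coincide_zero_ae m n : m != n ->
  {ae P, forall w, X m w = X n w -> X m w = 0}.
Proof.
move=> mn; have [PE _] := P_coincide (elimN eqP mn).
pose B := [set w | X m w = 0] `&` [set w | X n w = 0].
have mB : measurable B by exact: measurableI.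
have mA := measurableI _ _ (measurableC mB) (mE m n).
have BE : B `<=` [set w | X m w = X n w] by move=> w [/= -> ->].
have A0 : pr (~` B `&` [set w | X m w = X n w]) = 0.
  have := pr_splitI P mB (mE m n); rewrite PE (setIidl BE) -/B.
  by move=> e; apply: (@addrI _ (pr B)); rewrite addr0 -e.
apply: filterS (ae_not mA A0) => w nw Xmn.
by apply: contrapT => Xm; apply: nw; split => // -[].
Qed.

(** By [coincide_zero_ae] the events [X (u i) = x], for infinitely many times
    [u i] prime to [p], are almost surely disjoint; they all have the probability
    of [X 1 = x]. *)
Lemma no_atom (x : R) : x <> 0 -> P [set w | X 1%N w = x] = 0%E.
Proof.
move=> x0; pose u i := (p * i + 1)%N.
have u_inj i j : i != j -> u i != u j.
  by apply: contra; rewrite eqn_add2r eqn_pmul2l ?prime_gt0.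
have mx n : measurable [set w | X n w = x] by exact: measurable_eqs.
have pu i : ~~ (p %| u i)%N.
  by rewrite /u dvdn_addr ?dvdn1 ?gtn_eqF ?prime_gt1// dvdn_mulr.
have [N [N_meas N0 sN]] : {ae P, forall w, forall i j, i != j ->
    X (u i) w = X (u j) w -> X (u i) w = 0}.
  apply: ae_foralln => i; apply: ae_foralln => j.
  have [->|ij] := eqVneq i j; first exact: aeW.
  by apply: filterS (coincide_zero_ae (u_inj _ _ ij)) => w Xw _.
pose A i := [set w | X (u i) w = x] `\` N.
have mA i : measurable (A i) by exact: measurableD.
pose a := pr [set w | X 1%N w = x].
have PA i : P (A i) = a%:E.
  rewrite -(prK P (mx 1)) -(eq_distr_eq x (unit_law (pu i))).
  apply: eq_P_ae => //.
  exists N; split => // w; apply: contra_notP => Nw.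
  by rewrite /A/=; tauto.
have dA : trivIset setT A.
  apply/trivIsetP => i j _ _ ij; rewrite -subset0 => w [[Xi Nw] [Xj _]].
  apply: Nw; apply: sN => /= /(_ i j ij); rewrite Xi Xj => /(_ erefl).
  exact: x0.
rewrite (prK P (mx 1)) -/a; congr EFin; apply/le_anti; rewrite pr_ge0 andbT.
apply/ler_addgt0Pr => e e0; rewrite add0r.
pose n := (Num.bound e^-1).
have na : n%:R * a <= 1.
  have mU : measurable (\big[setU/set0]_(i < n) A i).
    by apply: bigsetU_measurable.
  have := probability_le1 P mU; rewrite measure_bigsetU//.
  rewrite (eq_bigr (fun=> a%:E)) => [|i _]; last exact: PA.
  by rewrite sumEFin lee_fin sumr_const card_ord mulr_natl.
have n1 : e^-1 < n%:R by rewrite archi_boundP// invr_ge0 ltW.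
have n0 : 0 < n%:R :> R by apply: lt_trans n1; rewrite invr_gt0.
rewrite -(ler_pM2l n0); apply: le_trans na _.
by rewrite -ler_pdivrMr// mul1r ltW.
Qed.

(** * The support of the marginal law *)

Lemma abs_band_ae (Y : T -> R) (t x y : R) : measurable_fun setT Y -> 0 < t ->
  eq_distr P Y (fun w => t * X 1%N w) ->
  P [set w | `|X 1%N w| < x] = 0%E -> P [set w | `|X 1%N w| > y] = 0%E ->
  {ae P, forall w, t * x <= `|Y w| <= t * y}.
Proof.
move=> mY t0 YX x0 y0.
have mtX : measurable_fun setT (fun w => t * X 1%N w) by exact: measurable_funM.
have norm_scale w : `|t * X 1%N w| = t * `|X 1%N w| by rewrite normrM gtr0_norm.
have lo : {ae P, forall w, ~ `|Y w| < t * x}.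
  apply: ae_not; first by apply: measurable_lts => //; exact: measurableT_comp.
  have := YX [set z | `|z| < t * x]; rewrite /preimage/= => ->.
    rewrite (_ : [set w | _] = [set w | `|X 1%N w| < x]) ?x0//.
    by apply/seteqP; split => w /=; rewrite norm_scale ltr_pM2l.
  by apply: measurable_lts => //; exact: measurable_normr.
have hi : {ae P, forall w, ~ t * y < `|Y w|}.
  apply: ae_not; first exact: measurable_gts_norm.
  rewrite (eq_distr_norm_gt _ YX).
  rewrite (_ : [set w | _] = [set w | `|X 1%N w| > y]) ?y0//.
  by apply/seteqP; split => w /=; rewrite norm_scale ltr_pM2l.
apply: filterS2 lo hi => w /negP; rewrite -leNgt => -> /negP.
by rewrite -leNgt.
Qed.

(** [four_point_gap] applies to the values at the times [0], [1], [p] and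
    [p + 1], whose differences are distributed as [X 1] or as
    [padic_ratio * X 1]. *)
Lemma lower_edge_grows (x y : R) : 0 < x ->
  P [set w | `|X 1%N w| < x] = 0%E -> P [set w | `|X 1%N w| > y] = 0%E ->
  y < (1 + 2 * r) * x -> P [set w | `|X 1%N w| < x * (1 + r)] = 0%E.
Proof.
move=> x0 Px Py yx.
have p1 : (1 < p)%N := prime_gt1 p_prime.
have p0 : (0 < p)%N := prime_gt0 p_prime.
have one_law (Y : T -> R) : eq_distr P Y (X 1%N) ->
    eq_distr P Y (fun w => 1 * X 1%N w).
  by move=> YX; under [X in eq_distr _ _ X]eq_fun do rewrite mul1r.
have pU : ~~ (p %| 1)%N by rewrite dvdn1 gtn_eqF.
have pS : ~~ (p %| 1 + p)%N by rewrite dvdn_addl.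
have pP : ~~ (p %| p.-1)%N.
  by rewrite gtnNdvd// ?ltn_predL// -ltnS prednK.
have p_law : eq_distr P (X p) (fun w => r * X 1%N w).
  by have := dilation_law 1 p0; rewrite muln1 logn_prime// eqxx expr1.
have B1 := abs_band_ae (mX 1) ltr01 (one_law _ (unit_law pU)) Px Py.
have B2 := abs_band_ae (mX p) r_gt0 p_law Px Py.
have B3 := abs_band_ae (mX (1 + p)) ltr01 (one_law _ (unit_law pS)) Px Py.
have B4 := abs_band_ae (mXB (p.-1 + 1) 1) ltr01
  (one_law _ (eq_distr_trans (stationary_law p.-1 1) (unit_law pP))) Px Py.
have B5 := abs_band_ae (mXB (p + 1) 1) r_gt0
  (eq_distr_trans (stationary_law p 1) p_law) Px Py.
have B6 := abs_band_ae (mXB (1 + p) p) ltr01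
  (one_law _ (stationary_law 1 p)) Px Py.
rewrite -[RHS](measure0 P); apply: eq_P_ae => //.
  by apply: measurable_lts => //; exact: measurableT_comp.
move: B1 B2 B3 B4 B5 B6; rewrite addn1 prednK// [(p + 1)%N]addnC !mul1r.
move=> B1 B2 B3 B4 B5 B6.
apply: filterS2 (filterI B1 (filterI B2 B3)) (filterI B4 (filterI B5 B6)) => w
  [b1 [b2 b3]] [b4 [b5 b6]]; split => // x1.
have := four_point_gap r_gt0 r_lt1 x0 b1 b2 b3 b4 b5 b6 x1.
by rewrite leNgt yx.
Qed.

(** If the inequality failed, then [lower_edge_grows] could be iterated, and the
    lower edge of the support of [`|X 1|] would pass the upper one. *)
Lemma edge_ratio (x y : R) : 0 <= x -> 0 < y ->
  P [set w | `|X 1%N w| < x] = 0%E -> P [set w | `|X 1%N w| > y] = 0%E ->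
  (1 + 2 * r) * x <= y.
Proof.
move=> x_ge0 y0 Px Py; have [->|x0] := eqVneq x 0; first by rewrite mulr0 ltW.
have {}x0 : 0 < x by rewrite lt_neqAle eq_sym x0.
rewrite leNgt; apply/negP => yx.
have r1 : 1 <= 1 + r by rewrite lerDl ltW.
have Pk k : P [set w | `|X 1%N w| < x * (1 + r) ^+ k] = 0%E.
  elim: k => [|k IH]; first by rewrite expr0 mulr1.
  rewrite exprSr mulrA; apply: (@lower_edge_grows _ y) => //.
    by rewrite mulr_gt0// exprn_gt0// (lt_le_trans ltr01).
  apply: lt_le_trans yx _; rewrite mulrA ler_peMr//; last exact: exprn_ege1.
  by rewrite mulr_ge0// addr_ge0// mulr_ge0// ltW.
have bernoulli k : 1 + k%:R * r <= (1 + r) ^+ k.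
  elim: k => [|k IH]; first by rewrite mul0r addr0 expr0.
  rewrite exprS -natr1; apply: (@le_trans _ _ ((1 + r) * (1 + k%:R * r))).
    have : 0 <= k%:R * (r * r) by rewrite !mulr_ge0// ltW.
    by rewrite mulrDl mul1r mulrDr mulrDl mulr1; lra.
  by rewrite ler_pM2l// (lt_le_trans ltr01).
pose k := Num.bound (y / x / r).
have yk : y < x * (1 + r) ^+ k.
  have : y / x / r < k%:R by rewrite archi_boundP// !divr_ge0// ltW.
  rewrite ltr_pdivrMr// ltr_pdivrMr// mulrC => /lt_le_trans; apply.
  by rewrite ler_pM2l//; apply: le_trans (bernoulli k); rewrite lerDr.
pose A := [set w | `|X 1%N w| < x * (1 + r) ^+ k].
pose B := [set w | y < `|X 1%N w|].
have mA : measurable A.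
  by apply: measurable_lts => //; exact: measurableT_comp.
have mB : measurable B by exact: measurable_gts_norm.
have AB : [set: T] `<=` A `|` B.
  move=> w _; have [|] := ltP `|X 1%N w| (x * (1 + r) ^+ k); first by left.
  by right; exact: lt_le_trans yk _.
have := le_pr_setU P measurableT mA mB AB.
by rewrite probability_setT Pk Py/= addr0 ler10.
Qed.

Lemma gap_bound :
  let a := ereal_sup [set x%:E | x in
       [set x : R | 0 <= x /\ P [set w | `|X 1%N w| < x] = 0%E]] in
  let beta := ereal_inf [set x%:E | x in
       [set x : R | 0 < x /\ P [set w | `|X 1%N w| > x] = 0%E]] in
  ((1 + 2 * r)%R%:E * a <= beta)%E.
Proof.
cbv zeta; have r1 : 0 < 1 + 2 * r by rewrite addr_gt0// mulr_gt0.
apply: le_ereal_inf_tmp => _ [y [y0 Py] <-].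
rewrite -lee_pdivlMl//; apply: ge_ereal_sup => _ [x [x0 Px] <-].
by rewrite -EFinM lee_fin mulrC ler_pdivlMr// mulrC; exact: edge_ratio.
Qed.

(** * Covariances *)

Lemma difference_law n m : exists2 t : R,
  t ^+ 2 = padic_norm R p (n%:Z - m%:Z) `^ (2 * H) &
  eq_distr P (fun w => X n w - X m w) (fun w => t * X 1%N w).
Proof.
have [mn|nm] := leqP m n.
  exists (padic_norm R p (n - m)%N `^ H); first by rewrite padic_norm_sqr subzn.
  apply: eq_distr_trans (one_dim_law (n - m)).
  by have := stationary_law (n - m) m; rewrite subnK.
exists (- padic_norm R p (m - n)%N `^ H).
  rewrite sqrrN padic_norm_sqr; congr ((_ `^ H) ^+ 2).
  by rewrite [RHS]padic_norm_abs (distnEr (ltnW nm)).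
have := eq_distr_comp mN
  (eq_distr_trans (stationary_law (m - n) n) (one_dim_law (m - n))).
rewrite (subnK (ltnW nm)) => + A mA => /(_ A mA).
rewrite (_ : -%R \o _ = (fun w => X n w - X m w)); last first.
  by apply/funext => w /=; rewrite opprB.
by move=> ->; congr (P (_ @^-1` A)); apply/funext => w /=; rewrite mulNr.
Qed.

(** Polarization: [X n], [X m] and [X n - X m] are all distributed as multiples
    of [X 1], so their variances are known. *)
Lemma covariance_formula : ('E_P[fun w => (X 1%N w ^+ 2)%R] < +oo)%E ->
  forall m n : nat, covariance P (X n) (X m) =
    ((2^-1 * (padic_norm R p n%:Z `^ (2 * H) + padic_norm R p m%:Z `^ (2 * H)
              - padic_norm R p (n%:Z - m%:Z) `^ (2 * H)))%:E
     * variance P (X 1%N))%E.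
Proof.
move=> X1sq m n; have X1 := Lfun2_sqr_finite (mX 1) X1sq.
have scale_L2 (t : R) : (fun w => t * X 1%N w) \in Lfun P 2%:E.
  have := Lfun_scale t (_ : 1 <= 2) X1.
  rewrite (_ : t \o* X 1%N = (fun w => t * X 1%N w)).
    by apply; rewrite ler1n.
  by apply/funext => w /=; rewrite mulrC.
have XL2 k : (X k : T -> R) \in Lfun P 2%:E.
  apply: eq_distr_Lfun2 (one_dim_law k) (scale_L2 _) => //.
  exact: measurable_funM.
have Pfin : P setT \is a fin_num by exact: fin_num_measure.
have varX k : variance P (X k) =
    ((padic_norm R p k%:Z `^ (2 * H))%:E * variance P (X 1%N))%E.
  by rewrite padic_norm_sqr; apply: variance_scale (one_dim_law k).
have [t tE nm_law] := difference_law n m.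
have varB := variance_scale (mXB n m) (mX 1) X1 nm_law.
rewrite tE in varB; have := varianceB (XL2 n) (XL2 m).
rewrite (_ : (X n \- X m)%R = (fun w => X n w - X m w))// varB (varX n) (varX m).
have := variance_fin_num X1.
have : covariance P (X n) (X m) \is a fin_num.
  apply: covariance_fin_num; [exact: (Lfun_subset12 Pfin)..|].
  exact: (Lfun2_mul_Lfun1 (XL2 n) (XL2 m)).
case: (covariance P (X n) (X m)) => // c _; case: (variance P (X 1%N)) => // v _.
rewrite -!EFinM -!EFinD => -[] e; congr EFin; lra.
Qed.

End Process.

Theorem proposition3p11 (d : measure_display) (T : measurableType d)
    (R : realType) (P : probability T R) (X : nat -> {RV P >-> R})
    (p : nat) (H : R) (p_prime : prime p) (H_gt0 : 0 < H)
    (X_ss_si : dt_ss_si X (fun n => padic_norm R p n%:Z `^ H)) :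
  (* (1) *)
  {ae P, forall w, X 0%N w = 0} /\
  (* (2) *)
  (forall n : nat,
     {ae P, forall w, seq_limit_point (fun k => X k w) (X n w)}) /\
  (* (3) *)
  (eq_distr P (X 1%N) (fun w => - X 1%N w) /\
   (('E_P[fun w => `|X 1%N w|%R] < +oo)%E ->
    forall n : nat, ('E_P[X n] = 0)%E)) /\
  (* (4) *)
  (forall m n : nat, m <> n ->
     P [set w | X m w = X n w] = P [set w | X m w = 0 /\ X n w = 0] /\
     P [set w | X m w = 0 /\ X n w = 0] =
       P [set w | forall i : nat, X i w = 0]) /\
  (* (5) *)
  (forall x : R, x <> 0 -> P [set w | X 1%N w = x] = 0%E) /\
  (* (6) *)
  (let a := ereal_sup [set x%:E | x in
       [set x : R | 0 <= x /\ P [set w | `|X 1%N w| < x] = 0%E]] in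
   let beta := ereal_inf [set x%:E | x in
       [set x : R | 0 < x /\ P [set w | `|X 1%N w| > x] = 0%E]] in
   ((1 + 2 * p%:R `^ (- H))%R%:E * a <= beta)%E) /\
  (* (7) *)
  (('E_P[fun w => (X 1%N w ^+ 2)%R] < +oo)%E ->
   forall m n : nat,
     covariance P (X n) (X m) =
       ((2^-1 * (padic_norm R p n%:Z `^ (2 * H) + padic_norm R p m%:Z `^ (2 * H)
                 - padic_norm R p (n%:Z - m%:Z) `^ (2 * H)))%:E
        * variance P (X 1%N))%E).
Proof.
split; first exact: (X0_ae p_prime H_gt0 X_ss_si).
split; first exact: (recurrent_ae p_prime H_gt0 X_ss_si).
split; first split.
- exact: (symmetric_law p_prime H_gt0 X_ss_si).
- exact: (expectation_eq0 p_prime H_gt0 X_ss_si).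
split; first exact: (P_coincide p_prime H_gt0 X_ss_si).
split; first exact: (no_atom p_prime H_gt0 X_ss_si).
split; first exact: (gap_bound p_prime H_gt0 X_ss_si).
exact: (covariance_formula p_prime H_gt0 X_ss_si).
Qed.
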